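(* Let $M$ be a pointed metric space which is not uniformly discrete and let $X$ be a non-zero Banach space. Then the norm of $\mathcal F(M)\widehat{\otimes}_\pi X$ is octahedral.
   Context: All Banach spaces are real. $\mathcal F(M)$ is the Lipschitz-free space over $M$ (closed linear span of evaluation functionals $\delta_p$ in the dual of the space $\mathrm{Lip}_0(M)$ of real Lipschitz functions vanishing at the base point), $\widehat{\otimes}_\pi$ is the projective tensor product. $M$ is uniformly discrete if $\inf\{d(x,y):x\neq y\}>0$. A Banach space $Z$ is octahedral if for every $x_1,\dots,x_n\in S_Z$ and $\varepsilon>0$ there is $y\in S_Z$ with $\|x_i-y\|\ge 2-\varepsilon$ for all $i$. *)

(* Defs.v *)
From Stdlib Require List.
From HB Require Import structures.
From mathcomp Require Import all_boot all_order all_algebra.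
From mathcomp Require Import all_classical all_reals all_analysis.
Set Implicit Arguments. Unset Strict Implicit. Unset Printing Implicit Defensive.
Import Order.TTheory GRing.Theory Num.Theory.
Import numFieldNormedType.Exports.
Local Open Scope ring_scope.
Local Open Scope classical_set_scope.

Definition octahedral (T : Type) (rT : realType) (Z : T -> Prop)
  (nrm : T -> rT) (sub : T -> T -> T) : Prop :=
  forall (xs : seq T) (eps : rT), 0 < eps ->
    (forall x, List.In x xs -> Z x /\ nrm x = 1) ->
    exists y, Z y /\ nrm y = 1 /\
      forall x, List.In x xs -> 2 - eps <= nrm (sub x y).

Section LipFreeTensor.
Variable R : realType.
Variable M : Type.
Variable d : M -> M -> R.
Variable x0 : M.

Definition is_metric : Prop :=
  (forall x y, 0 <= d x y) /\ (forall x y, d x y = 0 <-> x = y) /\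
  (forall x y, d x y = d y x) /\ (forall x y z, d x z <= d x y + d y z).

Definition uniformly_discrete : Prop :=
  exists c : R, 0 < c /\ forall x y, x <> y -> c <= d x y.

Definition lip_le (f : M -> R) (C : R) : Prop :=
  forall x y, `|f x - f y| <= C * d x y.
Definition Lip0 (f : M -> R) : Prop := f x0 = 0 /\ exists C, lip_le f C.
Definition Lip0_ball (f : M -> R) : Prop := f x0 = 0 /\ lip_le f 1.

Definition functional := (M -> R) -> R.
Definition dnorm (phi : functional) : \bar R :=
  ereal_sup [set (`|phi f|)%:E | f in Lip0_ball].

Definition lin_on_Lip0 (phi : functional) : Prop :=
  forall (a : R) f g, Lip0 f -> Lip0 g ->
    phi (fun x => a * f x + g x) = a * phi f + phi g.

(* F(M): the closed linear span of the evaluations delta_p in Lip_0(M)^*.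
   Elements are linear functionals on Lip_0(M), normalised to be 0 outside
   Lip_0(M) so that equality in F(M) is equality of functions. *)
Definition FM (phi : functional) : Prop :=
  lin_on_Lip0 phi /\ (forall f, ~ Lip0 f -> phi f = 0) /\
  forall e : R, 0 < e -> exists s : seq (R * M),
    (dnorm (fun f => (phi f - \sum_(q <- s) q.1 * f q.2)%R) < e%:E)%E.

Variable X : normedModType R.

(* algebraic tensors  sum_i phi_i (x) x_i  in F(M) (x) X, given by lists *)
Definition tensor := seq (functional * X).
Definition tensor_in (u : tensor) : Prop := forall q, List.In q u -> FM q.1.

Definition bilin (B : functional -> X -> R) : Prop :=
  (forall (a : R) phi psi x, FM phi -> FM psi ->
     B (fun f => a * phi f + psi f) x = a * B phi x + B psi x) /\
  (forall phi (a : R) (x y : X), FM phi -> B phi (a *: x + y) = a * B phi x + B phi y).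

Definition tev (B : functional -> X -> R) (u : tensor) : R :=
  \sum_(q <- u) B q.1 q.2.
(* equality in the algebraic tensor product F(M) (x) X
   (universal property: all bilinear forms agree) *)
Definition teq (u v : tensor) : Prop := forall B, bilin B -> tev B u = tev B v.

Definition pinorm (u : tensor) : \bar R :=
  ereal_inf [set (\sum_(q <- v) (dnorm q.1 * (`|q.2|)%:E))%E
            | v in [set v | tensor_in v /\ teq v u]].

Definition tsub (u v : tensor) : tensor :=
  u ++ map (fun q => ((fun f => - q.1 f), q.2)) v.

(* F(M) \hat(x)_pi X: completion of (F(M) (x) X, pinorm), realised as
   pinorm-Cauchy sequences of algebraic tensors (no quotient by null
   sequences is needed: norm and subtraction are compatible with it). *)
Definition projtensor (z : nat -> tensor) : Prop :=
  (forall n, tensor_in (z n)) /\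
  forall e : R, 0 < e -> exists N, forall m n, (N <= m)%N -> (N <= n)%N ->
    (pinorm (tsub (z m) (z n)) < e%:E)%E.

Definition projtensor_norm (z : nat -> tensor) : R :=
  limn (fun n => fine (pinorm (z n))).

Definition projtensor_sub (z w : nat -> tensor) : nat -> tensor :=
  fun n => tsub (z n) (w n).

Definition projtensor_octahedral : Prop :=
  octahedral projtensor projtensor_norm projtensor_sub.

End LipFreeTensor.

(* Main.v *)
(* Take points a, b at tiny distance and y = m_ab (x) x, where x has norm one and
   m_ab = (delta_a - delta_b) / d(a, b). Multiplying a 1-Lipschitz function f by
   a logarithmic cutoff around a makes it constant near a while changing it
   uniformly little, and its Lipschitz constant stays below 1 + e; call the
   result T f. A tent theta of height d(a, b) at a can then be added or
   subtracted at the further cost e. So the predual S of T satisfies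
   |S phi| + |phi(theta)| <= (1 + 2 e) |phi| on F(M), with S m_ab = 0,
   m_ab(theta) = 1, S phi close to phi and phi(theta) small for any phi fixed in
   advance. Tensoring with a norming functional l of x, the map
   (S (x) id, theta (x) l) into an l_1-sum sends u - y close to (u, -1), whence
   |u - y| is at least about |u| + 1. *)

Require Import Defs.
From HB Require Import structures.
From mathcomp Require Import all_boot all_order all_algebra.
From mathcomp Require Import all_classical all_reals all_analysis.
From mathcomp Require Import ring lra.
Import Order.TTheory GRing.Theory Num.Theory.
Import numFieldNormedType.Exports.
Set Implicit Arguments. Unset Strict Implicit. Unset Printing Implicit Defensive.
Local Open Scope ring_scope.
Local Open Scope classical_set_scope.

(** * Sublinear functionals and the Hahn-Banach theorem *)

Section Sublinear.
Variables (R : realType) (X : lmodType R).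
Implicit Types (p q : X -> R) (x y : X) (t c : R).

Definition sublinear q : Prop :=
  (forall x y, q (x + y) <= q x + q y) /\
  (forall t x, 0 <= t -> q (t *: x) <= t * q x).

Lemma sublinearZ q t x : sublinear q -> 0 <= t -> q (t *: x) = t * q x.
Proof.
move=> [qD qZ] t0; apply/eqP; rewrite eq_le qZ//=.
have [->|tn0] := eqVneq t 0.
  by rewrite scale0r mul0r; have := qD 0 0; rewrite addr0; lra.
have tp : 0 < t by rewrite lt_neqAle eq_sym tn0.
have := qZ t^-1 (t *: x).
rewrite invr_ge0 => /(_ t0); rewrite scalerA mulVf// scale1r.
by rewrite mulrC ler_pdivlMr// mulrC.
Qed.

Lemma sublinear0 q : sublinear q -> q 0 = 0.
Proof. by move=> sq; rewrite -(scale0r (0 : X)) sublinearZ// mul0r. Qed.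

Lemma sublinear_ge q x : sublinear q -> - q (- x) <= q x.
Proof.
move=> sq; have := sq.1 x (- x); rewrite subrr sublinear0//; lra.
Qed.

(** For sublinear [q], this is the largest sublinear functional below [q] whose value at [- y] is at
    most [- q y]; a linear minorant of it agrees with [q] at [y]. *)
Definition tilt q y x : R :=
  inf [set q (x + t *: y) - t * q y | t in [set t | 0 <= t]].

Lemma tilt_le q y x t : sublinear q -> 0 <= t ->
  tilt q y x <= q (x + t *: y) - t * q y.
Proof.
move=> sq t0; apply: ge_inf; last by exists t.
(* The lower bound comes from [s * q y = q (s *: y) <= q (x + s *: y) + q (- x)]. *)
exists (- q (- x)) => _ [s s0 <-].
rewrite -sublinearZ//; have := sq.1 (x + s *: y) (- x).
by rewrite addrAC subrr add0r; lra.
Qed.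

Lemma le_tilt q y x c :
  (forall t, 0 <= t -> c <= q (x + t *: y) - t * q y) -> c <= tilt q y x.
Proof.
move=> h; apply: lb_le_inf; first by exists (q (x + 0 *: y) - 0 * q y), 0 => /=.
by move=> _ [s s0 <-]; exact: h.
Qed.

Lemma tilt_le_id q y x : sublinear q -> tilt q y x <= q x.
Proof.
by move=> sq; have := tilt_le y x sq (lexx 0); rewrite scale0r addr0 mul0r subr0.
Qed.

(** Parameters add: terms for [x] at [s] and for [x'] at [s'] together dominate the term for
    [x + x'] at [s + s']. For positive [t] the parameter is rescaled by [t]. *)
Lemma sublinear_tilt q y : sublinear q -> sublinear (tilt q y).
Proof.
move=> sq; split=> [x x'|t x].
  rewrite -lerBlDr. apply: le_tilt => s s0; rewrite lerBlDr [leRHS]addrC -lerBlDr.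
  apply: le_tilt => s' s'0; rewrite lerBlDr.
  have := tilt_le y (x + x') sq (addr_ge0 s0 s'0).
  have := sq.1 (x + s *: y) (x' + s' *: y).
  by rewrite addrACA -scalerDl; lra.
rewrite le0r => /predU1P[->|t0].
  by rewrite scale0r mul0r (le_trans (tilt_le_id _ _ sq))// sublinear0.
rewrite mulrC -ler_pdivrMr//; apply: le_tilt => s s0.
rewrite ler_pdivrMr//.
have := tilt_le y (t *: x) sq (mulr_ge0 (ltW t0) s0).
rewrite -scalerA -scalerDr (sublinearZ _ sq (ltW t0)); lra.
Qed.

(* By Zorn there is a minimal sublinear functional below [p]; it coincides with
   all its tilts, which forces it to be additive. *)
Lemma linear_minorant p : sublinear p ->
  exists l : X -> R, (forall t x y, l (t *: x + y) = t * l x + l y) /\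
    forall x, l x <= p x.
Proof.
move=> sp.
pose T := {q : X -> R | sublinear q /\ forall x, q x <= p x}.
pose mk q (sq : sublinear q) (qp : forall x, q x <= p x) : T := exist _ q (conj sq qp).
(* The order is reversed, so that Zorn's maximal element is a minimal functional. *)
pose r (a b : T) := `[< forall x, sval b x <= sval a x >].
have [|||[q [sq qp]] /= qmin] := @ZL_preorder T (mk p sp (fun=> lexx _)) r.
- by move=> a; apply/asboolP.
- move=> b a c /asboolP ab /asboolP bc; apply/asboolP => x.
  exact: le_trans (bc x) (ab x).
- move=> A Atot; have [->|/set0P[a0 Aa0]] := eqVneq A set0.
    by exists (mk p sp (fun=> lexx _)).
  (* A nonempty chain is bounded by its pointwise infimum; comparability of any two members makes
     this infimum subadditive. *)
  pose E x := [set sval a x | a in A].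
  have lbE x a : A a -> inf (E x) <= sval a x.
    move=> Aa; apply: ge_inf; last by exists a.
    exists (- p (- x)) => _ [[b [sb bp]] Ab <-] /=.
    by apply: le_trans (sublinear_ge x sb); rewrite lerN2.
  have le_infE x c : (forall a, A a -> c <= sval a x) -> c <= inf (E x).
    move=> h; apply: lb_le_inf; first by exists (sval a0 x), a0.
    by move=> _ [a Aa <-]; exact: h.
  have sE : sublinear (fun x => inf (E x)).
    split=> [x y|t x].
      rewrite -lerBlDr; apply: (le_infE) => a Aa; rewrite lerBlDr [leRHS]addrC -lerBlDr.
      apply: (le_infE) => b Ab; rewrite lerBlDr.
      have [c Ac [ca cb]] : exists2 c, A c & sval c x <= sval a x /\ sval c y <= sval b y.
        by have [/asboolP h|/asboolP h] := Atot _ _ Aa Ab; [exists b|exists a].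
      apply: le_trans (lbE _ _ Ac) _; case: c Ac ca cb => c [sc cp] /= Ac ca cb.
      by apply: le_trans (sc.1 _ _) _; rewrite addrC lerD.
    rewrite le0r => /predU1P[->|t0].
      rewrite scale0r mul0r (le_trans (lbE _ _ Aa0))//.
      by case: a0 {Aa0} => c [sc cp] /=; rewrite sublinear0.
    rewrite mulrC -ler_pdivrMr//; apply: (le_infE) => a Aa.
    rewrite ler_pdivrMr// (le_trans (lbE _ _ Aa))// mulrC.
    by case: a {Aa} => c [sc cp] /=; apply: sc.2; rewrite ltW.
  have Ep x : inf (E x) <= p x.
    apply: le_trans (lbE _ _ Aa0) _; case: a0 {Aa0} => c [sc cp]; exact: cp.
  exists (mk _ sE Ep) => a Aa.
  by apply/asboolP => x /=; exact: lbE.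
have qtilt y x : q x <= tilt q y x.
  have tp z : tilt q y z <= p z := le_trans (tilt_le_id y z sq) (qp z).
  have := qmin (mk _ (sublinear_tilt y sq) tp).
  by move=> h; apply: (asboolP _ (h _)); apply/asboolP => z; exact: tilt_le_id.
have qD x y : q (x + y) = q x + q y.
  apply/eqP; rewrite eq_le sq.1/=.
  have := le_trans (qtilt y x) (tilt_le y x sq ler01).
  by rewrite scale1r mul1r lerBrDr.
have qN x : q (- x) = - q x.
  by apply/eqP; rewrite -addr_eq0 -qD addNr sublinear0.
exists q; split => // t x y; rewrite qD; congr (_ + _).
have [t0|t0] := leP 0 t; first exact: sublinearZ.
by rewrite -[t]opprK scaleNr qN sublinearZ ?mulNr// oppr_ge0 ltW.
Qed.

End Sublinear.

Lemma hahn_banach_norming (R : realType) (X : normedModType R) (x : X) :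
  exists l : X -> R, [/\ forall t y z, l (t *: y + z) = t * l y + l z,
    forall y, `|l y| <= `|y| & l x = `|x| ].
Proof.
have sp : sublinear (fun y : X => `|y|).
  split=> [y z|t y t0]; first exact: ler_normD.
  by rewrite normrZ ger0_norm.
(* Tilting the norm along [x] gives [l (- x) <= - `|x|]. *)
have [l [llin lp]] := linear_minorant (sublinear_tilt x sp).
have l0 : l 0 = 0.
  by have := llin 1 0 0; rewrite scale1r mul1r addr0; lra.
have lN y : l (- y) = - l y.
  by have := llin (-1) y 0; rewrite scaleN1r !addr0 l0 addr0 mulN1r.
have ln y : l y <= `|y| := le_trans (lp y) (tilt_le_id x y sp).
exists l; split=> // [y|]; first by rewrite ler_norml ln lerNl -lN -normrN ln.
apply/eqP; rewrite eq_le ln/=.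
have := le_trans (lp (- x)) (tilt_le x (- x) sp ler01).
rewrite scale1r addNr normr0 mul1r lN; lra.
Qed.

(** * Lipschitz functions, the dual norm and the free space *)

Section LipschitzFree.
Variables (R : realType) (M : Type) (d : M -> M -> R) (x0 : M).
Hypothesis d_metric : is_metric d.
Implicit Types (f g : M -> R) (phi psi : functional R M) (C a e : R).

Let d_ge0 p q : 0 <= d p q. Proof. exact: d_metric.1. Qed.

Lemma lip_le_bound f C C' : C <= C' -> lip_le d f C -> lip_le d f C'.
Proof. by move=> CC' fC p q; rewrite (le_trans (fC p q))// ler_wpM2r. Qed.

Lemma lip_leD f g C C' : lip_le d f C -> lip_le d g C' ->
  lip_le d (fun p => f p + g p) (C + C').
Proof.
move=> fC gC p q; rewrite mulrDl opprD addrACA.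
by rewrite (le_trans (ler_normD _ _))// lerD.
Qed.

Lemma lip_leZ a f C : lip_le d f C -> lip_le d (fun p => a * f p) (`|a| * C).
Proof. by move=> fC p q; rewrite -mulrBr normrM -mulrA ler_wpM2l. Qed.

Lemma Lip0_ballW f : Lip0_ball d x0 f -> Lip0 d x0 f.
Proof. by move=> [f0 f1]; split=> //; exists 1. Qed.

Lemma Lip0_lincomb a f g : Lip0 d x0 f -> Lip0 d x0 g ->
  Lip0 d x0 (fun p => a * f p + g p).
Proof.
move=> [f0 [C fC]] [g0 [C' gC]]; split; first by rewrite f0 g0 mulr0 addr0.
by exists (`|a| * C + C'); apply: lip_leD => //; exact: lip_leZ.
Qed.

Lemma Lip0_ball0 : Lip0_ball d x0 (fun=> 0).
Proof. by split=> // p q; rewrite subrr normr0 mul1r. Qed.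

Lemma Lip0_ball_div f C : 0 < C -> f x0 = 0 -> lip_le d f C ->
  Lip0_ball d x0 (fun p => C^-1 * f p).
Proof.
move=> C0 f0 fC; split; first by rewrite f0 mulr0.
by move/(lip_leZ C^-1): fC; rewrite gtr0_norm ?invr_gt0// mulVf ?gt_eqF.
Qed.

Lemma Lip0_scale_ball f : Lip0 d x0 f ->
  exists C g, [/\ 0 < C, Lip0_ball d x0 g & f = fun p => C * g p].
Proof.
(* [C] can be zero or, on a one-point space, negative. *)
move=> [f0 [C fC]]; have C1 : 0 < `|C| + 1 by rewrite ltr_wpDl.
exists (`|C| + 1), (fun p => (`|C| + 1)^-1 * f p); split=> //.
  apply: Lip0_ball_div => //; apply: lip_le_bound fC.
  by rewrite (le_trans (ler_norm _))// lerDl.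
by apply/funext => p; rewrite mulrA divff ?mul1r ?gt_eqF.
Qed.

Lemma dnorm_leP phi C :
  (dnorm d x0 phi <= C%:E)%E <-> forall f, Lip0_ball d x0 f -> `|phi f| <= C.
Proof.
split=> [h f fb|h].
  by rewrite -lee_fin (le_trans _ h)//; apply: ereal_sup_ubound; exists f.
by apply: ge_ereal_sup => _ [f fb <-]; rewrite lee_fin h.
Qed.

Lemma dnorm_ge0 phi : (0 <= dnorm d x0 phi)%E.
Proof.
apply: (@le_trans _ _ (`|phi (fun=> 0)|)%:E); first by rewrite lee_fin.
by apply: ereal_sup_ubound; exists (fun=> 0) => //; exact: Lip0_ball0.
Qed.

(** [fine] turns an infinite norm into 0; by [FM_fin_num] this does not happen on F(M). *)
Definition rnorm phi : R := fine (dnorm d x0 phi).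

Lemma rnorm_ge0 phi : 0 <= rnorm phi.
Proof. by rewrite fine_ge0// dnorm_ge0. Qed.

Lemma rnorm_le phi C :
  (forall f, Lip0_ball d x0 f -> `|phi f| <= C) -> rnorm phi <= C.
Proof.
move=> /dnorm_leP h; rewrite -lee_fin fineK//.
by rewrite ge0_fin_numE ?dnorm_ge0// (le_lt_trans h)// ltry.
Qed.

Lemma FM_lincomb a phi psi : FM d x0 phi -> FM d x0 psi ->
  FM d x0 (fun f => a * phi f + psi f).
Proof.
move=> [lphi [ophi aphi]] [lpsi [opsi apsi]]; split; last split.
- by move=> c f g Lf Lg; rewrite lphi// lpsi//; ring.
- by move=> f nLf; rewrite ophi// opsi// mulr0 addr0.
- move=> e e0.
  have e1 : 0 < e / 3 / (`|a| + 1).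
    by rewrite !divr_gt0// ltr_wpDl.
  have e2 : 0 < e / 3 by rewrite divr_gt0.
  have [s /ltW/dnorm_leP hs] := aphi _ e1.
  have [t /ltW/dnorm_leP ht] := apsi _ e2.
  exists ([seq (a * q.1, q.2) | q <- s] ++ t).
  apply: (@le_lt_trans _ _ (e / 3 + e / 3)%:E); last by rewrite lte_fin; lra.
  apply/dnorm_leP => f fb.
  rewrite big_cat big_map/= opprD addrACA.
  rewrite (le_trans (ler_normD _ _))// lerD ?ht//.
  under eq_bigr do rewrite -mulrA.
  rewrite -mulr_sumr -mulrBr normrM.
  apply: (@le_trans _ _ (`|a| * (e / 3 / (`|a| + 1)))).
    by rewrite ler_wpM2l// hs.
  rewrite mulrA ler_pdivrMr ?ltr_wpDl//.
  by rewrite mulrC ler_wpM2l ?lerDl// ltW.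
Qed.

Lemma FM0 : FM d x0 (fun=> 0).
Proof.
split; first by move=> *; rewrite mulr0 addr0.
split=> // e e0; exists [::].
apply: (@le_lt_trans _ _ 0%:E); last by rewrite lte_fin.
by apply/dnorm_leP => f fb; rewrite big_nil subrr normr0.
Qed.

Lemma FMN phi : FM d x0 phi -> FM d x0 (fun f => - phi f).
Proof.
move=> /(FM_lincomb (-1))/(_ FM0); congr FM.
by apply/funext => f; rewrite addr0 mulN1r.
Qed.

Lemma FMB phi psi : FM d x0 phi -> FM d x0 psi ->
  FM d x0 (fun f => phi f - psi f).
Proof.
move=> FMphi /(FM_lincomb (-1))/(_ FMphi); congr FM.
by apply/funext => f; rewrite mulN1r addrC.
Qed.

Lemma FM0r phi : FM d x0 phi -> phi (fun=> 0) = 0.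
Proof.
move=> [lphi _].
have := lphi 1 _ _ (Lip0_ballW Lip0_ball0) (Lip0_ballW Lip0_ball0).
suff -> : (fun p : M => 1 * (fun=> 0 : R) p + (fun=> 0 : R) p) = (fun=> 0).
  by rewrite mul1r; lra.
by apply/funext => p; rewrite mul1r addr0.
Qed.

Lemma FM_homog phi a f : FM d x0 phi -> Lip0 d x0 f ->
  phi (fun p => a * f p) = a * phi f.
Proof.
move=> FMphi Lf; have := FMphi.1 a f _ Lf (Lip0_ballW Lip0_ball0).
rewrite FM0r// addr0 => <-; congr phi.
by apply/funext => p; rewrite addr0.
Qed.

(** Within distance 1 lies a finite combination of evaluations, and evaluation at [p] is bounded by
    [d p x0] on the ball. *)
Lemma FM_fin_num phi : FM d x0 phi -> dnorm d x0 phi \is a fin_num.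
Proof.
move=> [_ [_ /(_ 1 ltr01) [s /ltW/dnorm_leP hs]]].
rewrite ge0_fin_numE ?dnorm_ge0//.
apply: (@le_lt_trans _ _ (1 + \sum_(q <- s) `|q.1| * d q.2 x0)%:E); last exact: ltry.
apply/dnorm_leP => f fb; rewrite -[phi f](subrK (\sum_(q <- s) q.1 * f q.2)).
rewrite (le_trans (ler_normD _ _))// lerD ?hs//.
rewrite (le_trans (ler_norm_sum _ _ _))//; apply: ler_sum => q _.
rewrite normrM ler_wpM2l//; have := fb.2 q.2 x0.
by rewrite fb.1 subr0 mul1r.
Qed.

Lemma ball_le_rnorm phi f : FM d x0 phi -> Lip0_ball d x0 f -> `|phi f| <= rnorm phi.
Proof.
move=> /FM_fin_num h; apply: (dnorm_leP _ _).1 f; by rewrite fineK.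
Qed.

Lemma FM_le phi f C : FM d x0 phi -> 0 < C -> f x0 = 0 -> lip_le d f C ->
  `|phi f| <= C * rnorm phi.
Proof.
move=> FMphi C0 f0 fC; have Lf : Lip0 d x0 f by split => //; exists C.
have := ball_le_rnorm FMphi (Lip0_ball_div C0 f0 fC).
by rewrite FM_homog// normrM gtr0_norm ?invr_gt0// mulrC ler_pdivrMr// mulrC.
Qed.

(** On functions with a common Lipschitz constant, elements of F(M) are continuous for uniform
    convergence: a finite combination of evaluations is small on uniformly small functions, and the
    approximation error scales with [C]. *)
Lemma FM_uniform_small phi C e : FM d x0 phi -> 0 < C -> 0 < e ->
  exists2 t, 0 < t & forall f, f x0 = 0 -> lip_le d f C ->
    (forall p, `|f p| <= t) -> `|phi f| <= e.
Proof.
move=> FMphi C0 e0.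
have e1 : 0 < e / 2 / C by rewrite !divr_gt0.
have [_ [_ /(_ _ e1) [s /ltW/dnorm_leP hs]]] := FMphi.
pose K := \sum_(q <- s) `|q.1|.
have K0 : 0 < K + 1 by rewrite ltr_wpDl// sumr_ge0.
exists (e / 2 / (K + 1)); first by rewrite !divr_gt0.
move=> f f0 fC ft; have Lf : Lip0 d x0 f by split => //; exists C.
rewrite -[phi f](subrK (\sum_(q <- s) q.1 * f q.2)) (splitr e).
rewrite (le_trans (ler_normD _ _))// lerD//.
  have := hs _ (Lip0_ball_div C0 f0 fC); rewrite FM_homog//.
  under eq_bigr do rewrite mulrCA.
  rewrite -mulr_sumr -mulrBr normrM gtr0_norm ?invr_gt0//.
  by rewrite mulrC ler_pM2r ?invr_gt0.
rewrite (le_trans (ler_norm_sum _ _ _))//.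
apply: (@le_trans _ _ (K * (e / 2 / (K + 1)))).
  by rewrite mulr_suml; apply: ler_sum => q _; rewrite normrM ler_wpM2l.
by rewrite mulrA ler_pdivrMr// mulrC ler_wpM2l ?lerDl// divr_ge0// ltW.
Qed.

(** * Preduals of operators on Lip_0(M) *)

Section Predual.
Variables (T : (M -> R) -> M -> R) (K : R).
Hypothesis K_gt0 : 0 < K.
Hypothesis T_lincomb : forall a f g,
  T (fun p => a * f p + g p) = fun p => a * T f p + T g p.
Hypothesis T_ball : forall f, Lip0_ball d x0 f -> T f x0 = 0 /\ lip_le d (T f) K.
Hypothesis T_eval : forall p, exists s : seq (R * M), forall f, Lip0 d x0 f ->
  T f p = \sum_(q <- s) q.1 * f q.2.

(** The cut outside Lip_0(M) meets the normalisation in [FM], as [T f] may be Lipschitz when [f] is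
    not. *)
Definition predual phi : functional R M :=
  fun f => if `[< Lip0 d x0 f >] then phi (T f) else 0.

Lemma predualE phi f : Lip0 d x0 f -> predual phi f = phi (T f).
Proof. by move=> Lf; rewrite /predual asboolT. Qed.

Lemma Lip0_predual f : Lip0 d x0 f -> Lip0 d x0 (T f).
Proof.
move=> /Lip0_scale_ball [C [g [C0 gb ->]]].
have [T0 TK] := T_ball gb.
have [Z0 ZK] := T_ball Lip0_ball0.
(* The zero summand gives the shape of [T_lincomb]; the image of 0 is controlled by [T_ball]. *)
have -> : (fun p => C * g p) = (fun p => C * g p + 0).
  by apply/funext => p; rewrite addr0.
by rewrite T_lincomb; apply: Lip0_lincomb; split=> //; exists K.
Qed.

Lemma predual_lincomb a phi psi :
  predual (fun f => a * phi f + psi f) = fun f => a * predual phi f + predual psi f.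
Proof.
apply/funext => f; rewrite /predual; case: ifP => // _.
by rewrite mulr0 addr0.
Qed.

(** By [T_eval], an evaluation composed with [T] is a finite combination of evaluations, so their
    span is preserved; the bound [K] carries this to the closure. *)
Lemma FM_predual phi : FM d x0 phi -> FM d x0 (predual phi).
Proof.
move=> FMphi; split; last split.
- move=> a f g Lf Lg; have [lphi _] := FMphi.
  rewrite !predualE//; last exact: Lip0_lincomb.
  by rewrite (T_lincomb a f g) lphi//; exact: Lip0_predual.
- by move=> f nLf; rewrite /predual asboolF.
- move=> e e0.
  have e1 : 0 < e / 2 / K by rewrite !divr_gt0.
  have [_ [_ /(_ _ e1) [s /ltW/dnorm_leP hs]]] := FMphi.
  have [t ht] : exists t : seq (R * M), forall f, Lip0 d x0 f ->
      \sum_(q <- s) q.1 * T f q.2 = \sum_(q <- t) q.1 * f q.2.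
    elim: s {hs} => [|[c p] s [t ht]]; first by exists [::] => f _; rewrite !big_nil.
    have [u hu] := T_eval p.
    exists ([seq (c * q.1, q.2) | q <- u] ++ t) => f Lf.
    rewrite big_cons/= ht// hu// big_cat big_map/= mulr_sumr.
    by under [in RHS]eq_bigr do rewrite -mulrA.
  exists t; apply: (@le_lt_trans _ _ (e / 2)%:E); last by rewrite lte_fin; lra.
  apply/dnorm_leP => f fb; have Lf := Lip0_ballW fb.
  rewrite predualE// -ht//.
  have [T0 TK] := T_ball fb.
  have := hs _ (Lip0_ball_div K_gt0 T0 TK); rewrite FM_homog//; last first.
    by split=> //; exists K.
  under eq_bigr do rewrite mulrCA.
  rewrite -mulr_sumr -mulrBr normrM gtr0_norm ?invr_gt0//.
  by rewrite mulrC ler_pM2r ?invr_gt0.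
Qed.

End Predual.

End LipschitzFree.

(** [List.In] matches [tensor_in], so that bounds valid on F(M) apply entry by entry. *)
Lemma ler_sum_In (R : realType) (T : Type) (s : seq T) (F G : T -> R) :
  (forall q, List.In q s -> F q <= G q) ->
  \sum_(q <- s) F q <= \sum_(q <- s) G q.
Proof.
elim: s => [|q s ih] h; first by rewrite !big_nil.
by rewrite !big_cons lerD ?h ?ih//=; [left|move=> p sp; apply: h; right].
Qed.

Lemma eq_sum_In (R : realType) (T : Type) (s : seq T) (F G : T -> R) :
  (forall q, List.In q s -> F q = G q) ->
  \sum_(q <- s) F q = \sum_(q <- s) G q.
Proof.
by move=> h; apply/eqP; rewrite eq_le !ler_sum_In// => q /h ->.
Qed.

(** * The projective norm on algebraic tensors *)

Section Tensor.
Variables (R : realType) (M : Type) (d : M -> M -> R) (x0 : M).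
Variable X : normedModType R.
Hypothesis d_metric : is_metric d.
Implicit Types (f g : M -> R) (phi psi : functional R M) (c e : R).
Implicit Types (u v w : tensor M X) (B : functional R M -> X -> R).

Let rn := rnorm d x0.

Definition cost u : R := \sum_(q <- u) rn q.1 * `|q.2|.
Definition rpinorm u : R := fine (pinorm d x0 u).

Lemma tensor_in_cat u v : tensor_in d x0 u -> tensor_in d x0 v ->
  tensor_in d x0 (u ++ v).
Proof.
by move=> hu hv q /(List.in_app_or u v)[]; [exact: hu|exact: hv].
Qed.

Lemma tensor_in_map (F : functional R M * X -> functional R M) u :
  (forall q, List.In q u -> FM d x0 (F q)) ->
  tensor_in d x0 (map (fun q => (F q, q.2)) u).
Proof. by move=> hF _ /List.in_map_iff[q [<- qu]]; exact: hF. Qed.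

Lemma tensor_in_tsub u v : tensor_in d x0 u -> tensor_in d x0 v ->
  tensor_in d x0 (tsub u v).
Proof.
move=> hu hv; apply: tensor_in_cat => //; apply: tensor_in_map => q qv.
by apply: FMN => //; exact: hv.
Qed.

Lemma cost_ge0 u : 0 <= cost u.
Proof. by apply: sumr_ge0 => q _; rewrite mulr_ge0// rnorm_ge0. Qed.

Lemma cost_cat u v : cost (u ++ v) = cost u + cost v.
Proof. exact: big_cat. Qed.

Lemma costE u : tensor_in d x0 u ->
  (\sum_(q <- u) (dnorm d x0 q.1 * (`|q.2|)%:E))%E = (cost u)%:E.
Proof.
elim: u => [|q u ih] hu; first by rewrite /cost !big_nil.
rewrite /cost !big_cons ih; last by move=> p pu; apply: hu; right.
rewrite -{1}[dnorm _ _ _]fineK ?EFinD ?EFinM//.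
by apply: FM_fin_num => //; apply: hu; left.
Qed.

Lemma teq_refl u : teq d x0 u u. Proof. by []. Qed.

Lemma teq_sym u v : teq d x0 u v -> teq d x0 v u.
Proof. by move=> uv B hB; rewrite uv. Qed.

Lemma teq_trans u v w : teq d x0 u v -> teq d x0 v w -> teq d x0 u w.
Proof. by move=> uv vw B hB; rewrite uv ?vw. Qed.

Lemma tev_cat B u v : tev B (u ++ v) = tev B u + tev B v.
Proof. exact: big_cat. Qed.

Lemma teq_cat u u' v v' : teq d x0 u u' -> teq d x0 v v' ->
  teq d x0 (u ++ v) (u' ++ v').
Proof. by move=> hu hv B hB; rewrite !tev_cat hu ?hv. Qed.

Lemma pinorm_ge0 u : (0 <= pinorm d x0 u)%E.
Proof.
apply: le_ereal_inf_tmp => _ [v [hv _] <-].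
by rewrite costE// lee_fin cost_ge0.
Qed.

Lemma pinorm_le_cost u v : tensor_in d x0 v -> teq d x0 u v ->
  (pinorm d x0 u <= (cost v)%:E)%E.
Proof.
move=> hv uv; apply: ereal_inf_lbound; exists v; last exact: costE.
by split=> //; exact: teq_sym.
Qed.

Lemma pinorm_fin_num u : tensor_in d x0 u -> pinorm d x0 u \is a fin_num.
Proof.
move=> hu; rewrite ge0_fin_numE ?pinorm_ge0//.
by rewrite (le_lt_trans (pinorm_le_cost hu (teq_refl u)))// ltry.
Qed.

Lemma rpinorm_le_cost u v : tensor_in d x0 v -> teq d x0 u v ->
  rpinorm u <= cost v.
Proof.
move=> hv uv; have h := pinorm_le_cost hv uv.
rewrite -lee_fin fineK// ge0_fin_numE ?pinorm_ge0//.
by rewrite (le_lt_trans h)// ltry.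
Qed.

Lemma le_rpinorm u c : tensor_in d x0 u ->
  (forall v, tensor_in d x0 v -> teq d x0 u v -> c <= cost v) -> c <= rpinorm u.
Proof.
move=> hu h; rewrite -lee_fin fineK ?pinorm_fin_num//.
apply: le_ereal_inf_tmp => _ [v [hv uv] <-].
by rewrite costE// lee_fin h//; exact: teq_sym.
Qed.

(** Every representation of [v] also represents [u]. *)
Lemma rpinorm_le_teq u v : tensor_in d x0 v -> teq d x0 u v ->
  rpinorm u <= rpinorm v.
Proof.
move=> hv uv; apply: le_rpinorm => // w hw vw.
by apply: rpinorm_le_cost => //; exact: teq_trans vw.
Qed.

(** Representations of [u] and [v] concatenate to one of [u ++ v], and their costs add. *)
Lemma rpinorm_cat u v : tensor_in d x0 u -> tensor_in d x0 v ->
  rpinorm (u ++ v) <= rpinorm u + rpinorm v.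
Proof.
move=> hu hv; rewrite -lerBlDr; apply: le_rpinorm => // u' hu' uu'.
rewrite lerBlDr addrC -lerBlDr; apply: le_rpinorm => // v' hv' vv'.
rewrite lerBlDr addrC -cost_cat; apply: rpinorm_le_cost.
  exact: tensor_in_cat.
exact: teq_cat.
Qed.

Lemma bilinB B phi psi x : bilin d x0 B -> FM d x0 phi -> FM d x0 psi ->
  B (fun f => phi f - psi f) x = B phi x - B psi x.
Proof.
move=> [hB _] Fphi Fpsi; rewrite addrC -mulN1r -hB//.
by congr B; apply/funext => f; rewrite mulN1r addrC.
Qed.

Lemma bilin0 B x : bilin d x0 B -> B (fun=> 0) x = 0.
Proof.
move=> hB; have F0 := FM0 d x0.
rewrite -[RHS](subrr (B (fun=> 0) x)) -bilinB//.
by congr B; apply/funext => f; rewrite subrr.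
Qed.

Lemma bilinN B phi x : bilin d x0 B -> FM d x0 phi ->
  B (fun f => - phi f) x = - B phi x.
Proof.
move=> hB Fphi; rewrite -sub0r -(bilin0 x hB) -bilinB//; last exact: FM0.
by congr B; apply/funext => f; rewrite sub0r.
Qed.

Lemma tev_tsub B u v : bilin d x0 B -> tensor_in d x0 v ->
  tev B (tsub u v) = tev B u - tev B v.
Proof.
move=> hB hv; rewrite tev_cat; congr (_ + _).
rewrite /tev big_map -sumrN; apply: eq_sum_In => q qv /=.
by rewrite (bilinN _ hB)//; exact: hv.
Qed.

Lemma rpinorm_tsub_triangle u v w : tensor_in d x0 u -> tensor_in d x0 v ->
  tensor_in d x0 w ->
  rpinorm (tsub u w) <= rpinorm (tsub u v) + rpinorm (tsub v w).
Proof.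
move=> hu hv hw; have huv := tensor_in_tsub hu hv.
have hvw := tensor_in_tsub hv hw.
apply: le_trans (rpinorm_cat huv hvw); apply: rpinorm_le_teq.
  exact: tensor_in_cat.
by move=> B hB; rewrite tev_cat !tev_tsub// addrA subrK.
Qed.

Lemma rpinorm_le_tsub u v : tensor_in d x0 u -> tensor_in d x0 v ->
  rpinorm u <= rpinorm (tsub u v) + rpinorm v.
Proof.
move=> hu hv; have huv := tensor_in_tsub hu hv.
apply: le_trans (rpinorm_cat huv hv); apply: rpinorm_le_teq.
  exact: tensor_in_cat.
by move=> B hB; rewrite tev_cat !tev_tsub// subrK.
Qed.

Section ElementaryForm.
Variables (l : X -> R).
Hypothesis l_lin : forall a x y, l (a *: x + y) = a * l x + l y.
Hypothesis l_le : forall x, `|l x| <= `|x|.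

Lemma bilin_elementary f : bilin d x0 (fun phi x => phi f * l x).
Proof. by split=> [a phi psi x _ _|phi a x y _]; rewrite ?l_lin; ring. Qed.

(** The form has norm at most one; evaluating it on all representations gives lower bounds for the
    projective norm. *)
Lemma elementary_le_cost f u : Lip0_ball d x0 f -> tensor_in d x0 u ->
  `|tev (fun phi x => phi f * l x) u| <= cost u.
Proof.
move=> fb hu; rewrite (le_trans (ler_norm_sum _ _ _))//.
apply: ler_sum_In => q qu; rewrite normrM ler_pM//.
by apply: ball_le_rnorm => //; exact: hu.
Qed.

End ElementaryForm.

Section MapPredual.
Variables (T : (M -> R) -> M -> R) (K : R).
Hypothesis K_gt0 : 0 < K.
Hypothesis T_lincomb : forall a f g,
  T (fun p => a * f p + g p) = fun p => a * T f p + T g p.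
Hypothesis T_ball : forall f, Lip0_ball d x0 f -> T f x0 = 0 /\ lip_le d (T f) K.
Hypothesis T_eval : forall p, exists s : seq (R * M), forall f, Lip0 d x0 f ->
  T f p = \sum_(q <- s) q.1 * f q.2.

Let S := predual d x0 T.

(** The map S (x) id on representations. *)
Definition tmap u : tensor M X := map (fun q => (S q.1, q.2)) u.

Lemma tensor_in_tmap u : tensor_in d x0 u -> tensor_in d x0 (tmap u).
Proof.
move=> hu; apply: (tensor_in_map (F := fun q => S q.1)) => q qu.
by apply: (FM_predual d_metric K_gt0) => //; exact: hu.
Qed.

(** Pulling bilinear forms back along [S] is how [tmap] is seen to respect [teq]. *)
Lemma bilin_predual B : bilin d x0 B -> bilin d x0 (fun phi x => B (S phi) x).
Proof.
have FS phi : FM d x0 phi -> FM d x0 (S phi).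
  by move=> Fphi; apply: (FM_predual d_metric K_gt0).
move=> [hB1 hB2]; split=> [a phi psi x Fphi Fpsi|phi a x y Fphi].
  by rewrite /S predual_lincomb hB1//; exact: FS.
by apply: hB2; exact: FS.
Qed.

End MapPredual.

End Tensor.

(** * A logarithmic cutoff on the line *)

Ltac minmax_lra :=
  repeat match goal with
  | |- context [Num.max ?x ?y] => case: (leP x y)
  | |- context [Num.min ?x ?y] => case: (leP x y)
  end; intros; lra.

(* [h t] is [e * ln (r / t)] truncated to [[0, 1]]: its slope is [e / t], so
   that a Lipschitz function vanishing at the centre can be multiplied by it
   at the cost [e] only. *)
Lemma log_cutoff (R : realType) (e r : R) : 0 < e -> 0 < r ->
  exists (r1 : R) (h : R -> R), [/\ 0 < r1, r1 <= r,
    forall t, 0 <= h t <= 1,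
    (forall t, t <= r1 -> h t = 1) /\ (forall t, r <= t -> h t = 0) &
    forall s t, 0 <= s -> s <= t -> `|h t - h s| * s <= e * (t - s)].
Proof.
(* [r1] solves [e * ln (r / r1) = 1]: there the logarithm reaches height 1. *)
move=> e0 r0; pose r1 := r * expR (- e^-1).
have r1_gt0 : 0 < r1 by rewrite mulr_gt0// expR_gt0.
have r1r : r1 <= r.
  by rewrite ger_pMr// -expR0 ler_expR oppr_le0 invr_ge0 ltW.
pose m t := Num.min (Num.max t r1) r.
have mr1 t : r1 <= m t by rewrite /m le_min r1r andbT le_max lexx orbT.
have mr t : m t <= r by rewrite /m ge_min lexx orbT.
have m0 t : 0 < m t := lt_le_trans r1_gt0 (mr1 t).
have lnr1 : ln r1 = ln r - e^-1.
  by rewrite lnM ?posrE ?expR_gt0// expRK.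
have ln_mono (x y : R) : 0 < x -> x <= y -> ln x <= ln y.
  by move=> x0 xy; rewrite ler_ln ?posrE// (lt_le_trans x0).
exists r1, (fun t => e * (ln r - ln (m t))); split=> //.
- move=> t; have h1 := ln_mono _ _ (m0 t) (mr t).
  have h2 := ln_mono _ _ r1_gt0 (mr1 t).
  rewrite mulr_ge0 ?subr_ge0 ?(ltW e0)//=.
  by rewrite -(@mulfV _ e) ?gt_eqF// ler_pM2l//; lra.
- split=> t ht.
    have -> : m t = r1 by rewrite /m max_r// min_l.
    by rewrite lnr1 opprB addrC subrK divff// gt_eqF.
  have -> : m t = r by rewrite /m min_r// le_max ht.
  by rewrite subrr mulr0.
- move=> s t s0 st.
  have -> : e * (ln r - ln (m t)) - e * (ln r - ln (m s)) =
    - (e * (ln (m t) - ln (m s))) by ring.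
  have mst : m s <= m t by rewrite /m; minmax_lra.
  have := ln_mono _ _ (m0 s) mst => lst.
  rewrite normrN normrM gtr0_norm// ger0_norm ?subr_ge0// -mulrA ler_pM2l//.
  (* Beyond [r] the clamped [m s] drops below [s], but there both values of the cutoff vanish. *)
  have [sr|rs] := leP s r; last first.
    have -> : m s = r by rewrite /m; minmax_lra.
    have -> : m t = r by rewrite /m; minmax_lra.
    by rewrite subrr mul0r subr_ge0.
  have sm : s <= m s by rewrite /m; minmax_lra.
  have mm : m t - m s <= t - s by rewrite /m; minmax_lra.
  apply: le_trans mm.
  (* This is [ln (1 + u) <= u] at [u = (m t - m s) / m s]; the factor [s <= m s] then absorbs the
     denominator. *)
  have h : ln (m t) - ln (m s) <= (m t - m s) / m s.
    rewrite -ln_div ?posrE//.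
    have -> : m t / m s = 1 + (m t - m s) / m s.
      by rewrite mulrBl divff ?gt_eqF// addrC subrK.
    apply: le_ln1Dx; apply: (@lt_le_trans _ _ 0); first by rewrite ltrN10.
    by rewrite divr_ge0 ?subr_ge0// ltW.
  apply: (@le_trans _ _ ((m t - m s) / m s * m s)); last first.
    by rewrite divfK// gt_eqF.
  by rewrite ler_pM// ?subr_ge0.
Qed.

(** * Flattening and tents near a close pair of points *)

Section Perturbation.
Variables (R : realType) (M : Type) (d : M -> M -> R) (x0 : M).
Hypothesis d_metric : is_metric d.

(* [(1 - eta) f + eta (f a)], shifted by a constant so as to vanish at [x0]. *)
Definition flatten_at (eta : M -> R) (a : M) (f : M -> R) : M -> R :=
  fun p => (1 - eta p) * f p + (eta p - eta x0) * f a.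

(** [eta] is the cutoff and [theta] the tent; [r] makes both changes uniformly small. In
    [perturbation_lip], the values [c = 1] and [c = -1] serve the l_1 estimate, and [c = 0] bounds
    the flattening alone. *)
Record perturbation (e r : R) (a b : M) (eta theta : M -> R) : Prop :=
  Perturbation {
  perturbation_dist_gt0 : 0 < d a b;
  perturbation_eta : eta a = 1 /\ eta b = 1;
  perturbation_theta0 : theta x0 = 0;
  perturbation_theta_slope : theta a - theta b = d a b;
  perturbation_theta_lip : lip_le d theta 1;
  perturbation_theta_small : forall p, `|theta p| <= r;
  perturbation_flatten_close : forall f, Lip0_ball d x0 f ->
    forall p, `|flatten_at eta a f p - f p| <= 2 * r;
  perturbation_lip : forall f c, Lip0_ball d x0 f -> `|c| <= 1 ->
    lip_le d (fun p => flatten_at eta a f p + c * theta p) (1 + 2 * e) }.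

(** The tent lives well inside the plateau where [eta] is 1 and flattened functions are constant, so
    there it varies alone. When one point is off the plateau, the cutoff and the tent each add at
    most [e] to the Lipschitz constant. *)
Lemma perturbation_exists (e r : R) : ~ uniformly_discrete d -> 0 < e -> 0 < r ->
  exists a b eta theta, perturbation e r a b eta theta.
Proof.
move=> nud e0 r0.
have [r1 [h [r1_gt0 r1r h01 [h1 h0] hlip]]] := log_cutoff e0 r0.
have [dge0 [deq0 [dC dtri]]] := d_metric.
have e1 : 0 < e / (1 + e) by rewrite divr_gt0// addr_gt0.
have e11 : e / (1 + e) < 1 by rewrite ltr_pdivrMr ?mul1r ?ltrDr// addr_gt0.
(* The bound gives [s < r1] and [s <= e * (r1 - s)] for [s = d a b]: the height of the tent is at
   most [e] times the gap between its support and the edge of the plateau. *)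
have [a [b [ab sab]]] : exists a b, a <> b /\ d a b < e / (1 + e) * r1.
  apply: contrapT => nab; apply: nud; exists (e / (1 + e) * r1).
  split=> [|p q pq]; first by rewrite mulr_gt0.
  by rewrite leNgt; apply/negP => lt; apply: nab; exists p, q.
have dab : 0 < d a b.
  by rewrite lt_neqAle dge0 andbT; apply/eqP => /esym/deq0.
set s := d a b in dab sab *.
have s_r1 : s < r1 by rewrite (lt_le_trans sab)// ger_pMl// ltW.
have s_e : s <= e * (r1 - s).
  move: sab; rewrite mulrAC ltr_pdivlMr ?addr_gt0//; lra.
have daa : d a a = 0 by exact/deq0.
have dtri' p q : d p a - d q a <= d p q by have := dtri p q a; lra.
pose eta p := h (d p a); pose tent p := Num.max (s - d p a) 0.
have tent_lip p q : `|tent p - tent q| <= d p q.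
  have := dtri' p q; have := dtri' q p; rewrite (dC q p) /tent ler_norml; minmax_lra.
have tent01 p : 0 <= tent p <= s by have := dge0 p a; rewrite /tent; minmax_lra.
exists a, b, eta, (fun p => tent p - tent x0); split=> //.
- by rewrite /eta daa !h1// ?(ltW r1_gt0)// dC ltW.
- by rewrite subrr.
- by rewrite /tent daa (dC b a) -/s; minmax_lra.
- by move=> p q; rewrite mul1r opprB addrA subrK; exact: tent_lip.
- by move=> p; have := tent01 p; have := tent01 x0; rewrite ler_norml; lra.
- move=> f [f0 f1] p.
  (* [eta] vanishes beyond distance [r] from [a], and within it [f] differs from [f a] by at most
     [r]. *)
  have small q : `|eta q * (f a - f q)| <= r.
    rewrite normrM (ger0_norm (andP (h01 _)).1).
    have [dr|rd] := leP r (d q a); first by rewrite /eta h0// mul0r ltW.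
    have := f1 a q; rewrite mul1r dC => fq.
    rewrite -[leRHS]mul1r ler_pM ?(andP (h01 _)).1 ?(andP (h01 _)).2//.
    by rewrite (le_trans fq)// ltW.
  have -> : flatten_at eta a f p - f p =
      eta p * (f a - f p) - eta x0 * (f a - f x0).
    by rewrite /flatten_at f0; ring.
  rewrite (le_trans (ler_normB _ _))//.
  by have := small p; have := small x0; lra.
- move=> f c [f0 f1] c1 p q.
  (* The decomposition below pairs the increment of [eta] with the point nearer to [a], as the slope
     bound [hlip] requires. *)
  wlog pq : p q / d q a <= d p a.
    move=> H; have [|/ltW] := leP (d q a) (d p a); first exact: H.
    by move=> /H; rewrite distrC (dC q p).
  have -> : flatten_at eta a f p + c * (tent p - tent x0) -
      (flatten_at eta a f q + c * (tent q - tent x0)) =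
    (1 - eta p) * (f p - f q) + (eta q - eta p) * (f q - f a)
      + c * (tent p - tent q) by rewrite /flatten_at; ring.
  have ct : `|c * (tent p - tent q)| <= `|tent p - tent q|.
    by rewrite normrM ler_piMl.
  have [pr1|r1p] := leP (d p a) r1.
    rewrite /eta !h1//; last exact: le_trans pq pr1.
    rewrite subrr !mul0r !add0r (le_trans ct)// (le_trans (tent_lip _ _))//.
    by rewrite ler_peMl// lerDl mulr_ge0// ltW.
  have tp : tent p = 0 by rewrite /tent; minmax_lra.
  (* Either the tent vanishes at both points, or [q] is within [s] of [a] while [p] is beyond [r1],
     so that [d p q] is at least [r1 - s]. *)
  have tq : `|tent p - tent q| <= e * d p q.
    rewrite tp sub0r normrN ger0_norm ?(andP (tent01 _)).1//.
    have [sq|qs] := leP s (d q a).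
      have -> : tent q = 0 by rewrite /tent; minmax_lra.
      by rewrite mulr_ge0// ltW.
    rewrite (le_trans (andP (tent01 _)).2)// (le_trans s_e)// ler_pM2l//.
    by have := dtri' p q; lra.
  have h2 : `|(1 - eta p) * (f p - f q)| <= d p q.
    rewrite normrM -[leRHS]mul1r ler_pM//; last by have := f1 p q; rewrite mul1r.
    by have := h01 (d p a); rewrite /eta ler_norml; lra.
  have h3 : `|(eta q - eta p) * (f q - f a)| <= e * d p q.
    rewrite normrM distrC; apply: le_trans (_ : e * (d p a - d q a) <= _).
      apply: le_trans (hlip _ _ (dge0 q a) pq); rewrite ler_wpM2l//.
      by have := f1 q a; rewrite mul1r.
    by rewrite ler_pM2l.
  rewrite (le_trans (ler_normD _ _))//.
  rewrite (le_trans (lerD (ler_normD _ _) (le_trans ct tq)))//; lra.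
Qed.

Variables (eta : M -> R) (a : M).

Lemma flatten_lincomb (c : R) (f g : M -> R) :
  flatten_at eta a (fun p => c * f p + g p) =
  fun p => c * flatten_at eta a f p + flatten_at eta a g p.
Proof. by apply/funext => p; rewrite /flatten_at; ring. Qed.

Lemma flatten_eval (p : M) : exists s : seq (R * M), forall f : M -> R,
  flatten_at eta a f p = \sum_(q <- s) q.1 * f q.2.
Proof.
exists [:: (1 - eta p, p); (eta p - eta x0, a)] => f.
by rewrite !big_cons big_nil addr0.
Qed.

End Perturbation.

(** The minimum of finitely many thresholds works for all entries. *)
Lemma common_threshold (R : realType) (T : Type) (s : seq T) (P : T -> R -> Prop) :
  (forall q, List.In q s -> exists2 t, 0 < t & forall r, r <= t -> P q r) ->
  exists2 t, 0 < t & forall q, List.In q s -> forall r, r <= t -> P q r.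
Proof.
elim: s => [|q s ih] h; first by exists 1.
have [t t0 ht] := h q (or_introl erefl).
have [|t' t'0 ht'] := ih; first by move=> p ps; apply: h; right.
exists (Num.min t t'); first by rewrite lt_min t0.
move=> p [<-|ps] r; rewrite le_min => /andP[rt rt']; first exact: ht.
exact: ht'.
Qed.

(** * The octahedrality estimate for algebraic tensors *)

Section Estimate.
Variables (R : realType) (M : Type) (d : M -> M -> R) (x0 : M).
Hypothesis d_metric : is_metric d.
Implicit Types (phi : functional R M) (f g : M -> R) (c e eps r t : R).

Let rn := rnorm d x0.

Definition molecule a b : functional R M :=
  fun f => if `[< Lip0 d x0 f >] then (f a - f b) / d a b else 0.

Lemma moleculeE a b f : Lip0 d x0 f -> molecule a b f = (f a - f b) / d a b.
Proof. by move=> Lf; rewrite /molecule asboolT. Qed.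

Lemma FM_molecule a b : FM d x0 (molecule a b).
Proof.
split; last split.
- move=> c f g Lf Lg; rewrite !moleculeE//; last exact: Lip0_lincomb.
  by ring.
- by move=> f nLf; rewrite /molecule asboolF.
- move=> e e0; exists [:: ((d a b)^-1, a); (- (d a b)^-1, b)].
  apply: (@le_lt_trans _ _ 0%:E); last by rewrite lte_fin.
  apply/dnorm_leP => f fb; rewrite moleculeE; last exact: Lip0_ballW.
  rewrite !big_cons big_nil/= normr_le0; apply/eqP; ring.
Qed.

Lemma rnorm_molecule a b : 0 < d a b -> rn (molecule a b) <= 1.
Proof.
move=> ab0; apply: (rnorm_le d_metric) => f fb; rewrite moleculeE; last exact: Lip0_ballW.
by rewrite normrM normfV (gtr0_norm ab0) ler_pdivrMr//; exact: fb.2.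
Qed.

Lemma FM_sub phi f g : FM d x0 phi -> Lip0 d x0 f -> Lip0 d x0 g ->
  phi (fun p => f p - g p) = phi f - phi g.
Proof.
move=> Fphi Lf Lg; have [lphi _] := Fphi.
have := lphi (-1) g f Lg Lf; rewrite mulN1r addrC => <-.
by congr phi; apply/funext => p; rewrite mulN1r addrC.
Qed.

Section Perturbed.
Variables (e r : R) (a b : M) (eta theta : M -> R).
Hypothesis e_gt0 : 0 < e.
Hypothesis pert : perturbation d x0 e r a b eta theta.

Let T := flatten_at x0 eta a.
Let S := predual d x0 T.
Let K_gt0 : 0 < 1 + 2 * e. Proof. by rewrite addr_gt0// mulr_gt0. Qed.

Lemma flatten_ball f : Lip0_ball d x0 f -> T f x0 = 0 /\ lip_le d (T f) (1 + 2 * e).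
Proof.
move=> fb; split; first by rewrite /T /flatten_at fb.1 subrr mul0r mulr0 addr0.
have := perturbation_lip pert fb (c := 0); rewrite normr0 => /(_ ler01).
by congr lip_le; apply/funext => p; rewrite mul0r addr0.
Qed.

Let T_eval p : exists s : seq (R * M), forall f, Lip0 d x0 f ->
  T f p = \sum_(q <- s) q.1 * f q.2.
Proof. by have [s hs] := flatten_eval x0 eta a p; exists s. Qed.

Let T_lincomb c f g : T (fun p => c * f p + g p) = fun p => c * T f p + T g p.
Proof. exact: flatten_lincomb. Qed.

Lemma theta_ball : Lip0_ball d x0 theta.
Proof.
by split; [exact: perturbation_theta0 pert|exact: perturbation_theta_lip pert].
Qed.

Lemma FM_flatten phi : FM d x0 phi -> FM d x0 (S phi).
Proof. by move=> Fphi; apply: (FM_predual d_metric K_gt0) => //; exact: flatten_ball. Qed.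

(** For [f] in the ball, the sum of the absolute values of [phi (T f)] and [phi theta] is attained
    by [phi] on [T f + theta] or [T f - theta] up to sign, and both functions are Lipschitz with
    constant [1 + 2 * e]. *)
Lemma rnorm_flatten phi : FM d x0 phi ->
  rn (S phi) + `|phi theta| <= (1 + 2 * e) * rn phi.
Proof.
move=> Fphi; rewrite -lerBrDr; apply: (rnorm_le d_metric) => f fb; rewrite lerBrDr.
have [T0 TK] := flatten_ball fb.
have LT : Lip0 d x0 (T f) by split=> //; exists (1 + 2 * e).
have Lth := Lip0_ballW theta_ball.
have bound c : `|c| = 1 -> `|phi (T f) + c * phi theta| <= (1 + 2 * e) * rn phi.
  move=> c1; have [lphi _] := Fphi.
  rewrite addrC -lphi//; apply: FM_le => //.
    by rewrite T0 (perturbation_theta0 pert) mulr0 addr0.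
  have := perturbation_lip pert fb (c := c); rewrite c1 => /(_ (lexx 1)).
  by congr lip_le; apply/funext => p; rewrite addrC.
rewrite /S predualE; last exact: Lip0_ballW.
have := bound 1 (normr1 R); have := bound (-1) (normrN1 R).
rewrite mul1r mulN1r !ler_norml => /andP[b1 b2] /andP[b3 b4].
by case: (ger0P (phi (T f))); case: (ger0P (phi theta)); lra.
Qed.

(** As [eta] is 1 at both points, [T f] takes the same value at [a] and [b]. *)
Lemma flatten_molecule : S (molecule a b) = fun=> 0.
Proof.
apply/funext => f; rewrite /S /predual; case: ifPn => // /asboolP Lf.
rewrite moleculeE; last by apply: Lip0_predual => //; exact: flatten_ball.
have [ea eb] := perturbation_eta pert.
by rewrite /T /flatten_at ea eb subrr !mul0r subrr mul0r.
Qed.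

Lemma molecule_theta : molecule a b theta = 1.
Proof.
rewrite moleculeE; last exact: Lip0_ballW theta_ball.
by rewrite (perturbation_theta_slope pert) divff// gt_eqF// (perturbation_dist_gt0 pert).
Qed.

End Perturbed.

(** The flattening error and [theta] are uniformly small with Lipschitz constant at most
    [2 + 2 * e], so [FM_uniform_small] handles both. *)
Lemma flatten_close phi e eps : FM d x0 phi -> 0 < e -> 0 < eps ->
  exists2 t, 0 < t & forall r, r <= t -> forall a b eta theta,
    perturbation d x0 e r a b eta theta ->
    rn (fun f => phi f - predual d x0 (flatten_at x0 eta a) phi f) <= eps /\
    `|phi theta| <= eps.
Proof.
move=> Fphi e0 eps0.
have C0 : 0 < 2 + 2 * e by rewrite addr_gt0// mulr_gt0.
have [t t0 ht] := FM_uniform_small d_metric Fphi C0 eps0.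
(* Halved because flattening moves a function by up to [2 * r]. *)
exists (t / 2); first by rewrite divr_gt0.
move=> r rt a b eta theta pert; split; last first.
  have [th0 th1] := theta_ball pert; apply: ht => //.
    by apply: lip_le_bound th1 => //; lra.
  by move=> p; have := perturbation_theta_small pert p; lra.
apply: (rnorm_le d_metric) => f fb; have Lf := Lip0_ballW fb.
have [T0 TK] := flatten_ball pert fb.
have LT : Lip0 d x0 (flatten_at x0 eta a f) by split=> //; exists (1 + 2 * e).
rewrite predualE// distrC -FM_sub//; apply: ht.
- by rewrite T0 fb.1 subrr.
- have := lip_leD TK (lip_leZ (-1) fb.2); rewrite normrN1 mul1r.
  have -> : 1 + 2 * e + 1 = 2 + 2 * e by ring.
  by congr lip_le; apply/funext => p; rewrite mulN1r.
- by move=> p; have := perturbation_flatten_close pert fb p; lra.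
Qed.

Variable X : normedModType R.
Implicit Types (u v w : tensor M X).

(** Summing [rnorm_flatten] over a representation [v] of the difference bounds
    [(1 + 2 * e) * cost v] below by the cost of its image plus the value of the form given by
    [theta] and [l]. The first is nearly the norm of [u], the second nearly 1. *)
Lemma rpinorm_tsub_molecule u (x : X) e eps : tensor_in d x0 u -> `|x| = 1 ->
  0 < e -> 0 < eps ->
  exists2 t, 0 < t & forall r, r <= t -> forall a b eta theta,
    perturbation d x0 e r a b eta theta ->
    rpinorm d x0 u + 1 - eps <=
      (1 + 2 * e) * rpinorm d x0 (tsub u [:: (molecule a b, x)]).
Proof.
move=> hu x1 e0 eps0.
pose L := \sum_(q <- u) `|q.2|.
have L0 : 0 <= L by apply: sumr_ge0.
have L1 : 0 < L + 1 by rewrite ltr_wpDl.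
(* A tolerance [c] for each functional, weighted by the norms of the vectors, adds up to at most
   [eps / 2]. *)
pose c := eps / 2 / (L + 1).
have c0 : 0 < c by rewrite !divr_gt0.
have cL : c * L <= eps / 2.
  by rewrite /c mulrAC ler_pdivrMr// ler_wpM2l ?lerDl// divr_ge0// ltW.
have [t t0 ht] := common_threshold (fun q qu => flatten_close (hu q qu) e0 c0).
exists t => // r rt a b eta theta pert.
have {}ht q qu := ht q qu r rt a b eta theta pert.
have [l [llin lle lx]] := hahn_banach_norming x.
set T := flatten_at x0 eta a in ht *; pose S := predual d x0 T.
have K0 : 0 < 1 + 2 * e by rewrite addr_gt0// mulr_gt0.
have T_lin := @flatten_lincomb R M x0 eta a.
have T_eval p : exists s : seq (R * M), forall f, Lip0 d x0 f ->
    T f p = \sum_(q <- s) q.1 * f q.2.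
  by have [s hs] := flatten_eval x0 eta a p; exists s.
have FS := FM_flatten e0 pert.
set m := molecule a b; have Fm : FM d x0 m := FM_molecule a b.
pose y : tensor M X := [:: (m, x)].
have hy : tensor_in d x0 y by move=> q [<-|[]].
have huy := tensor_in_tsub hu hy.
have htu : tensor_in d x0 (tmap d x0 T u).
  by apply: (tensor_in_tmap d_metric K0) => //; exact: flatten_ball pert.
pose D : tensor M X := [seq ((fun f => q.1 f - S q.1 f), q.2) | q <- u].
have hD : tensor_in d x0 D.
  apply: (tensor_in_map (F := fun q f => q.1 f - S q.1 f)) => q /hu Fq.
  by apply: FMB => //; exact: FS.
have close : rpinorm d x0 u <= rpinorm d x0 (tmap d x0 T u) + eps / 2.
  apply: (@le_trans _ _ (rpinorm d x0 (tmap d x0 T u) + rpinorm d x0 D)).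
    apply: le_trans (rpinorm_cat d_metric htu hD).
    apply: rpinorm_le_teq => //; first exact: tensor_in_cat.
    move=> B hB; rewrite tev_cat /tev !big_map -big_split/=.
    apply: eq_sum_In => q /hu Fq.
    rewrite -[LHS](subrK (B (S q.1) q.2)) addrC.
    by rewrite -(bilinB q.2 hB Fq (FS _ Fq)).
  rewrite lerD2l; apply: le_trans (rpinorm_le_cost d_metric hD (teq_refl D)) _.
  apply: le_trans cL; rewrite /cost big_map mulr_sumr.
  by apply: ler_sum_In => q /ht[h _]; rewrite ler_wpM2r.
have small : `|tev (fun phi x => phi theta * l x) u| <= eps / 2.
  apply: le_trans cL; rewrite (le_trans (ler_norm_sum _ _ _))// mulr_sumr.
  by apply: ler_sum_In => q /ht[_ h]; rewrite normrM ler_pM.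
rewrite -ler_pdivrMl//; apply: le_rpinorm => // v hv uv.
rewrite ler_pdivrMl//.
have htv : tensor_in d x0 (tmap d x0 T v).
  by apply: (tensor_in_tmap d_metric K0) => //; exact: flatten_ball pert.
(* [S] kills the molecule, so the image of [v] equals that of [u]. *)
have uTv : teq d x0 (tmap d x0 T u) (tmap d x0 T v).
  have hB' B := @bilin_predual _ _ _ _ X d_metric T (1 + 2 * e) K0 T_lin
    (flatten_ball pert) T_eval B.
  move=> B /[dup] hB /hB' hBS; have := uv _ hBS.
  rewrite (tev_tsub _ hBS hy) {2}/tev big_seq1/= (flatten_molecule pert).
  rewrite (bilin0 _ hB) subr0.
  by rewrite /tev !big_map.
(* On [v] the form takes its value on [u], which is small, minus 1. *)
have elem := uv _ (bilin_elementary d x0 llin theta).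
rewrite (tev_tsub _ (bilin_elementary d x0 llin theta) hy) in elem.
rewrite [X in _ - X]/tev big_seq1/= /m (molecule_theta pert) lx x1 mulr1 in elem.
have : cost d x0 (tmap d x0 T v) + `|tev (fun phi x => phi theta * l x) v|
    <= (1 + 2 * e) * cost d x0 v.
  apply: (@le_trans _ _ (\sum_(q <- v) (rn (S q.1) + `|q.1 theta|) * `|q.2|)).
    under eq_bigr do rewrite mulrDl.
    rewrite big_split/= /cost big_map lerD2l (le_trans (ler_norm_sum _ _ _))//.
    by apply: ler_sum_In => q qv; rewrite normrM ler_wpM2l.
  rewrite mulr_sumr; apply: ler_sum_In => q qv; rewrite mulrA ler_wpM2r//.
  exact: (rnorm_flatten e0 pert (hv q qv)).
have := rpinorm_le_cost d_metric htv uTv.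
have : 1 - eps / 2 <= `|tev (fun phi x => phi theta * l x) v|.
  rewrite -elem; move: small; rewrite ler_norml => /andP[_ small].
  by rewrite distrC; apply: le_trans (ler_norm _); lra.
lra.
Qed.

End Estimate.

(** * Passage to the completion *)

Lemma cauchy_seq_cvg (R : realType) (w : nat -> R) :
  (forall e : R, 0 < e -> exists N, forall m n, (N <= m)%N -> (N <= n)%N ->
    w m - w n < e) -> cvgn w.
Proof.
move=> h; apply/cauchy_cvgP; apply/cauchyP => e e0.
have [N hN] := h e e0; exists (w N); exists N => // n /= Nn.
(* The one-sided hypothesis, used in both orders, bounds the absolute value. *)
have := hN n N Nn (leqnn N); have := hN N n (leqnn N) Nn.
by rewrite /ball/= ltr_norml; lra.
Qed.

Section Completion.
Variables (R : realType) (M : Type) (d : M -> M -> R) (x0 : M).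
Variable X : normedModType R.
Hypothesis d_metric : is_metric d.
Implicit Types (u v y : tensor M X) (z : nat -> tensor M X).

Let rp := @rpinorm R M d x0 X.

Lemma projtensor_rpinorm z : projtensor d x0 z -> forall e, 0 < e ->
  exists N, forall m n, (N <= m)%N -> (N <= n)%N -> rp (tsub (z m) (z n)) < e.
Proof.
move=> [hz cz] e e0; have [N hN] := cz e e0; exists N => m n Nm Nn.
rewrite -lte_fin fineK ?hN//; apply: pinorm_fin_num => //.
by apply: tensor_in_tsub.
Qed.

Lemma cvg_rpinorm z : projtensor d x0 z -> cvgn (fun n => rp (z n)).
Proof.
move=> pz; apply: cauchy_seq_cvg => e /(projtensor_rpinorm pz)[N hN].
exists N => m n Nm Nn; apply: le_lt_trans (hN m n Nm Nn).
by rewrite lerBlDr; apply: rpinorm_le_tsub => //; apply: pz.1.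
Qed.

Lemma cvg_rpinorm_tsub z y : projtensor d x0 z -> tensor_in d x0 y ->
  cvgn (fun n => rp (tsub (z n) y)).
Proof.
move=> pz hy; apply: cauchy_seq_cvg => e /(projtensor_rpinorm pz)[N hN].
exists N => m n Nm Nn; apply: le_lt_trans (hN m n Nm Nn).
by rewrite lerBlDr; apply: rpinorm_tsub_triangle => //; apply: pz.1.
Qed.

Lemma projtensor_cst y : tensor_in d x0 y -> projtensor d x0 (fun=> y).
Proof.
move=> hy; split=> // e e0; exists 0 => _ _ _ _.
(* The empty list represents [y - y] at cost 0. *)
apply: (@le_lt_trans _ _ (cost d x0 ([::] : tensor M X))%:E).
  apply: pinorm_le_cost => // B hB.
  by rewrite (tev_tsub _ hB hy) subrr /tev big_nil.
by rewrite /cost big_nil lte_fin.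
Qed.

(** The single pair costs at most 1, and the form given by [theta] and a norming functional of [x]
    takes the value 1 on it. *)
Lemma rpinorm_molecule (x : X) e r a b eta theta :
  perturbation d x0 e r a b eta theta -> `|x| = 1 ->
  rp [:: (molecule d x0 a b, x)] = 1.
Proof.
move=> pert x1; have Fm := FM_molecule d x0 a b.
have hy : tensor_in d x0 [:: (molecule d x0 a b, x)] by move=> q [<-|[]].
apply/eqP; rewrite eq_le; apply/andP; split.
  rewrite (le_trans (rpinorm_le_cost d_metric hy (teq_refl _)))//.
  rewrite /cost big_seq1/= x1 mulr1.
  by apply: rnorm_molecule => //; exact: perturbation_dist_gt0 pert.
have [l [llin lle lx]] := hahn_banach_norming x.
apply: le_rpinorm => // v hv yv.
apply: le_trans (elementary_le_cost d_metric lle (theta_ball pert) hv).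
rewrite -(yv _ (bilin_elementary d x0 llin theta)) /tev big_seq1/= lx x1.
by rewrite (molecule_theta pert) mulr1 normr1.
Qed.

(** The algebraic estimate is applied to one late term [z N]; later terms are within [c] of it, so
    the bound survives in the limit. *)
Lemma projtensor_norm_tsub_molecule z (x : X) c :
  projtensor d x0 z -> projtensor_norm d x0 z = 1 -> `|x| = 1 -> 0 < c ->
  exists2 t, 0 < t & forall r, r <= t -> forall a b eta theta,
    perturbation d x0 c r a b eta theta ->
    2 - 7 * c <= projtensor_norm d x0
      (projtensor_sub z (fun=> [:: (molecule d x0 a b, x)])).
Proof.
move=> pz z1 x1 c0.
have z_cvg := cvg_rpinorm pz.
have zlim : rp (z n) @[n --> \oo] --> (1 : R) by rewrite -z1.
have [N1 hN1] := projtensor_rpinorm pz c0.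
have [N [N1N hN]] : exists N, (N1 <= N)%N /\ 1 - c <= rp (z N).
  have [N0 _ hN0] : \forall n \near \oo, 1 - c < rp (z n).
    by apply: (cvgr_gt 1) => //; lra.
  exists (maxn N0 N1); split; first exact: leq_maxr.
  by apply/ltW/hN0; exact: leq_maxl.
have [t t0 ht] := rpinorm_tsub_molecule d_metric (pz.1 N) x1 c0 c0.
exists t => // r rt a b eta theta pert.
set y := [:: _]; have hy : tensor_in d x0 y.
  by move=> q [<-|[]]//; exact: FM_molecule.
(* This follows from [(2 - 6 * c) * (1 + 2 * c) <= 2 - 2 * c]; the distance to later terms costs the
   seventh [c]. *)
have est : 2 - 6 * c <= rp (tsub (z N) y).
  have C0 : 0 < 1 + 2 * c by rewrite addr_gt0// mulr_gt0.
  rewrite -(ler_pM2l C0); have := ht r rt a b eta theta pert.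
  have := mulr_ge0 (ltW c0) (ltW c0).
  rewrite -/rp -/y; nra.
apply: limr_ge; first exact: cvg_rpinorm_tsub.
exists N => // n /= Nn.
have N1n := leq_trans N1N Nn.
have tri := rpinorm_tsub_triangle d_metric (pz.1 N) (pz.1 n) hy.
have := hN1 N n N1N N1n.
rewrite -/(rpinorm d x0 _) -/rp /projtensor_sub; rewrite -/rp in tri; lra.
Qed.

End Completion.

Theorem theorem4p1 (R : realType) (M : Type) (d : M -> M -> R) (x0 : M)
    (X : completeNormedModType R) :
  is_metric d -> ~ uniformly_discrete d ->
  (exists x : X, x <> 0%R) ->
  projtensor_octahedral d x0 X.
Proof.
move=> d_metric nud [x' /eqP x'0] zs eps eps0 hzs.
pose x : X := `|x'|^-1 *: x'.
have x1 : `|x| = 1 by rewrite normrZ normfV normr_id mulVf ?normr_eq0.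
pose c := eps / 7; have c0 : 0 < c by rewrite divr_gt0.
(* One threshold for all the given elements lets a single pair of points serve them all. *)
have [t t0 ht] := common_threshold (fun z hz =>
  projtensor_norm_tsub_molecule d_metric (hzs z hz).1 (hzs z hz).2 x1 c0).
have [a [b [eta [theta pert]]]] := perturbation_exists x0 d_metric nud c0 t0.
exists (fun=> [:: (molecule d x0 a b, x)]); split; last split.
- by apply: projtensor_cst => // q [<-|[]]//; exact: FM_molecule.
- rewrite /projtensor_norm -/(rpinorm _ _ _) (rpinorm_molecule d_metric pert x1).
  exact: lim_cst.
- move=> z /ht /(_ t (lexx t) a b eta theta pert); apply: le_trans.
  by rewrite /c; lra.
Qed.
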